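(* For every integer $\ell\ge 1$, let $H_\ell$ be the disjoint union of two copies of the complete graph $K_{\ell+1}$. Choose one vertex in each copy, call them $u$ and $v$, and let $G_\ell=H_\ell+uv$ be the graph obtained by adding the edge $uv$. Then \[ Z^+_{(\ell)}(G_\ell)=Z_{(\ell)}(G_\ell)=2\ell, \qquad Z^+_{(\ell)}(H_\ell)=Z_{(\ell)}(H_\ell)=2\ell+2 . \] Thus, for every $\ell\ge1$, $Z^+_{(\ell)}(G_\ell)-Z^+_{(\ell)}(G_\ell-uv)=Z_{(\ell)}(G_\ell)-Z_{(\ell)}(G_\ell-uv)=-2$.
   Context: All graphs are finite and simple. Color-change rules on a graph $X$ with current blue set $B$ (all other vertices white). PSD rule: if $C$ is the vertex set of a connected component of $X-B$, a blue vertex $x\in B$ may force $y\in C$ (turn $y$ blue) when $N_X(x)\cap C=\{y\}$. Standard rule: the same with $C$ replaced by the full white set $V(X)\setminus B$. Forces are applied one after another, with the blue set (and the white components) updated after each force. A leak is a vertex forbidden to perform a force. A set $B\subseteq V(X)$ is an $\ell$-leaky PSD forcing set (resp. $\ell$-leaky standard forcing set) of $X$ if for every $L\subseteq V(X)$ with $|L|=\ell$ there is, starting from the initial blue set $B$, a sequence of PSD (resp. standard) forces, none performed by a vertex of $L$, after which all vertices are blue. $Z^+_{(\ell)}(X)$ (resp. $Z_{(\ell)}(X)$) is the minimum size of such a set, where $0\le\ell\le|V(X)|$. *)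

(* Defs.v *)
From HB Require Import structures.
From mathcomp Require Import all_boot all_order all_algebra.
Set Implicit Arguments.
Unset Strict Implicit.
Unset Printing Implicit Defensive.

Record sgraph := SGraph {
  vertex :> finType;
  adj : rel vertex;
  adj_sym : symmetric adj;
  adj_irrefl : irreflexive adj }.

Definition neighbours (X : sgraph) (x : X) : {set X} := [set y | adj x y].

Section Constructions.

Fact complete_sym n : symmetric (fun i j : 'I_n => i != j).
Proof. by move=> i j; rewrite eq_sym. Qed.

Fact complete_irrefl n : irreflexive (fun i j : 'I_n => i != j).
Proof. by move=> i; rewrite eqxx. Qed.

Definition complete_graph (n : nat) : sgraph :=
  SGraph (@complete_sym n) (@complete_irrefl n).

Variables X Y : sgraph.

Definition disjoint_union_adj (p q : X + Y) : bool :=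
  match p, q with
  | inl x, inl x' => adj x x'
  | inr y, inr y' => adj y y'
  | _, _ => false
  end.

Fact disjoint_union_sym : symmetric disjoint_union_adj.
Proof. by case=> p [] q //=; rewrite adj_sym. Qed.

Fact disjoint_union_irrefl : irreflexive disjoint_union_adj.
Proof. by case=> p /=; rewrite adj_irrefl. Qed.

Definition disjoint_union : sgraph :=
  SGraph disjoint_union_sym disjoint_union_irrefl.

Variables a b : X.

(* The conjunct [x != y] only serves to keep the graph loopless when a = b. *)
Definition add_edge_adj (x y : X) : bool :=
  adj x y || (x != y) && ([set x; y] == [set a; b]).

Fact add_edge_sym : symmetric add_edge_adj.
Proof. by move=> x y; rewrite /add_edge_adj adj_sym eq_sym setUC. Qed.

Fact add_edge_irrefl : irreflexive add_edge_adj.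
Proof. by move=> x; rewrite /add_edge_adj adj_irrefl eqxx. Qed.

Definition add_edge : sgraph := SGraph add_edge_sym add_edge_irrefl.

Definition del_edge_adj (x y : X) : bool :=
  adj x y && ([set x; y] != [set a; b]).

Fact del_edge_sym : symmetric del_edge_adj.
Proof. by move=> x y; rewrite /del_edge_adj adj_sym setUC. Qed.

Fact del_edge_irrefl : irreflexive del_edge_adj.
Proof. by move=> x; rewrite /del_edge_adj adj_irrefl. Qed.

Definition del_edge : sgraph := SGraph del_edge_sym del_edge_irrefl.

End Constructions.

Section Forcing.

Variable X : sgraph.
Implicit Types (B C L : {set X}) (x y : X).

Definition adj_outside B : rel X :=
  [rel x y | [&& x \notin B, y \notin B & adj x y]].

Definition white_components B : {set {set X}} :=
  equivalence_partition (connect (adj_outside B)) (~: B).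

Definition forces_into B C x y : bool :=
  [&& x \in B, y \in C & neighbours x :&: C == [set y]].

Definition psd_force B x y : bool :=
  [exists C in white_components B, forces_into B C x y].

Definition standard_force B x y : bool := forces_into B (~: B) x y.

(* A colour-change rule: [rule B x y] says that x may force y when B is blue. *)
Variable rule : {set X} -> rel X.

Definition force_step L : rel {set X} :=
  [rel B B' | [exists x, exists y,
    [&& x \notin L, rule B x y & B' == y |: B]]].

Definition leaky_forcing (l : nat) B : bool :=
  [forall L : {set X}, (#|L| == l) ==> connect (force_step L) B setT].

Lemma leaky_forcingT l : leaky_forcing l setT.
Proof. by apply/forallP => L; apply/implyP => _; apply: connect0. Qed.

(* [setT] is always leaky forcing, so [arg min] returns a genuine minimiser. *)
Definition leaky_number (l : nat) : nat :=
  #|[arg min_(B < [set: X] | leaky_forcing l B) #|B|]|.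

Lemma leaky_numberP l n :
  leaky_number l = n <->
  (exists2 B, leaky_forcing l B & #|B| = n) /\
  (forall B, leaky_forcing l B -> n <= #|B|).
Proof.
rewrite /leaky_number; case: arg_minnP => [|B fB minB].
  exact: leaky_forcingT.
split=> [<-|[[B' fB' <-] minB']]; first by split=> //; exists B.
by apply/eqP; rewrite eqn_leq minB // minB'.
Qed.

End Forcing.

Definition Zpsd (l : nat) (X : sgraph) : nat := leaky_number (@psd_force X) l.

Definition Zstd (l : nat) (X : sgraph) : nat :=
  leaky_number (@standard_force X) l.

Definition Hgraph (l : nat) : sgraph :=
  disjoint_union (complete_graph l.+1) (complete_graph l.+1).

Definition Ggraph (l : nat) (u v : complete_graph l.+1) : sgraph :=
  @add_edge (Hgraph l) (inl u) (inr v).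

(* Main.v *)
Require Import Defs.
From mathcomp Require Import all_boot all_order all_algebra.
Set Implicit Arguments.
Unset Strict Implicit.
Unset Printing Implicit Defensive.
Import GRing.Theory.
Local Open Scope ring_scope.

(** A vertex of degree [l] must lie in every [l]-leaky forcing set: if it is
    white and its neighbours are the leaks, nothing can force it. Deleting [uv]
    leaves an [l]-regular graph, in which every vertex must therefore be blue
    initially; in [G], only [u] and [v], of degree [l + 1], may be white.
    Leaving exactly those two white works: more than [l] blue vertices see
    exactly one of them, so one of the two gets forced, and the other one then
    has [l + 1] blue neighbours, not all of which can leak. *)

Section Forcing.

Variable X : sgraph.
Implicit Types (B L : {set X}) (x y w : X) (l : nat).

(** The white component of [y] lies inside the white set and contains [y], so if [y] is the only
    white neighbour of [x], it is also the only one in that component. *)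
Lemma standard_force_psd B x y : standard_force B x y -> psd_force B x y.
Proof.
case/and3P=> Bx By /eqP NxB; apply/existsP.
(* This is the block of [y] in the very form in which [equivalence_partition] builds it. *)
exists [set z in ~: B | connect (adj_outside B) y z].
rewrite imset_f //= /forces_into Bx inE By connect0 /=.
apply/eqP/setP=> z; move/setP/(_ z): NxB; rewrite !inE andbA => ->.
by case: eqP => // ->; rewrite connect0.
Qed.

Lemma standard_force_adj B x y : standard_force B x y -> adj x y.
Proof. by case/and3P=> _ _ /eqP/setP/(_ y); rewrite !inE eqxx => /andP[]. Qed.

Lemma psd_force_adj B x y : psd_force B x y -> adj x y.
Proof.
case/existsP=> C /andP[_ /and3P[_ _ /eqP/setP/(_ y)]].
by rewrite !inE eqxx => /andP[].
Qed.

Lemma leaky_forcing_sub (r r' : {set X} -> rel X) l B :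
    (forall B' x y, r B' x y -> r' B' x y) ->
  leaky_forcing r l B -> leaky_forcing r' l B.
Proof.
move=> sub_r /forallP fB; apply/forallP=> L; apply/implyP=> sL.
move: (implyP (fB L) sL); apply: connect_sub => B1 B2 step.
apply: connect1; case/existsP: step => x /existsP[y /and3P[Lx rxy B2E]].
by apply/existsP; exists x; apply/existsP; exists y; rewrite Lx sub_r.
Qed.

(** The leaks are taken to be [neighbours w]. By induction along the sequence of forces, no step can
    add [w], since its forcer would be adjacent to [w] and hence a leak. Only adjacency of forces
    matters, so the argument covers both rules. *)
Lemma leaky_forcing_degree (r : {set X} -> rel X) l B w :
    (forall B' x y, r B' x y -> adj x y) ->
  #|neighbours w| = l -> leaky_forcing r l B -> w \in B.
Proof.
move=> r_adj deg_w /forallP/(_ (neighbours w)); rewrite deg_w eqxx /=.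
case/connectP=> p; elim: p B => [|B' p IHp] B /=; first by move=> _ <-; rewrite inE.
case/andP=> /existsP[x /existsP[y /and3P[xNw rxy /eqP ->]]] path_p lastE.
have := IHp _ path_p lastE; rewrite in_setU1 => /orP[/eqP wE|//].
by move: xNw; rewrite inE wE adj_sym (r_adj _ _ _ rxy).
Qed.

Lemma leaky_number_regular (r : {set X} -> rel X) l :
    (forall B x y, r B x y -> adj x y) ->
    (forall w : X, #|neighbours w| = l) ->
  leaky_number r l = #|X|.
Proof.
move=> r_adj deg; apply/leaky_numberP; split.
  by exists setT; [exact: leaky_forcingT | rewrite cardsT].
move=> B fB; rewrite -cardsT subset_leq_card //; apply/subsetP=> w _.
exact: leaky_forcing_degree fB.
Qed.

Lemma standard_forcing_pair l a b :
    (0 < l)%N -> [disjoint neighbours a & neighbours b] ->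
    #|neighbours a| = l.+1 -> #|neighbours b| = l.+1 ->
  leaky_forcing (@standard_force X) l (~: [set a; b]).
Proof.
move=> l_gt0 disj deg_a deg_b; apply/forallP=> L; apply/implyP=> /eqP cardL.
have not_both x : adj a x -> adj b x = false.
  by move=> ax; have := disjointFr disj (x := x); rewrite !inE => ->.
have last_force w : #|neighbours w| = l.+1 ->
    force_step (@standard_force X) L (~: [set w]) setT.
  move=> deg_w; have /subsetPn[x]: ~~ (neighbours w \subset L).
    by apply/negP=> /subset_leq_card; rewrite deg_w cardL ltnn.
  rewrite inE => wx Lx; apply/existsP; exists x; apply/existsP; exists w.
  rewrite Lx /= setUCr eqxx andbT /standard_force /forces_into setCK !inE eqxx.
  rewrite (contraTneq _ wx) => [|->]; last by rewrite adj_irrefl.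
  by rewrite /=; apply/eqP/setIidPr; rewrite sub1set inE adj_sym.
(* Stated for an arbitrary ordering of the pair, so that it applies whichever of [a] and [b] is
   forced first. *)
have first_force w w' x : [set w; w'] = [set a; b] -> x \notin [set a; b] ->
    x \notin L -> adj w x -> ~~ adj w' x -> w != w' ->
    force_step (@standard_force X) L (~: [set a; b]) (~: [set w']).
  move=> <- xab Lx wx w'x ww'; apply/existsP; exists x; apply/existsP; exists w.
  rewrite Lx /= /standard_force /forces_into setCK in_setC xab set21 /=.
  apply/andP; split; apply/eqP/setP=> z; rewrite !inE.
    case: (z =P w) => [->|_] /=; first by rewrite adj_sym wx.
    by case: (z =P w') => [->|_]; rewrite ?andbF // andbT adj_sym (negPf w'x).
  by case: (z =P w) => [->|_] //=; rewrite ww'.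
(* The vertices [a] and [b] may be adjacent, so up to two of the [2 * l + 2] neighbours are white.
   At least [2 * l] blue ones remain, more than [l] because [0 < l]. *)
have /subsetPn[x]: ~~ ((neighbours a :|: neighbours b) :\: [set a; b] \subset L).
  apply/negP=> /subset_leq_card; rewrite cardL leqNgt cardsD cardsU.
  rewrite (disjoint_setI0 disj) cards0 deg_a deg_b subn0.
  have : (#|(neighbours a :|: neighbours b) :&: [set a; b]| <= 2)%N.
    by rewrite (leq_trans (subset_leq_card (subsetIr _ _))) // cards2; case: eqP.
  move=> le2; case/negP; apply: leq_trans (leq_sub2l _ le2).
  by rewrite addSn addnS !subSS subn0 -addn1 leq_add2l.
have ab : a != b.
  apply/eqP=> abE; move: disj; rewrite -abE -setI_eq0 setIid -cards_eq0.
  by rewrite deg_a.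
rewrite in_setD => /andP[xab]; rewrite !inE => /orP[ax|bx] Lx.
  apply: (connect_trans (y := ~: [set b])); apply: connect1.
    by apply: (first_force a b x); rewrite ?not_both.
  exact: last_force.
apply: (connect_trans (y := ~: [set a])); apply: connect1.
  apply: (first_force b a x) => //; [exact: setUC | | by rewrite eq_sym].
  by apply: contraL bx => /not_both ->.
exact: last_force.
Qed.

(** The rule is squeezed between standard forcing, which gives the upper bound, and adjacency, which
    gives the lower one; both colour-change rules fit. *)
Lemma leaky_number_pair (r : {set X} -> rel X) l a b :
    (forall B x y, standard_force B x y -> r B x y) ->
    (forall B x y, r B x y -> adj x y) ->
    (0 < l)%N -> [disjoint neighbours a & neighbours b] ->
    #|neighbours a| = l.+1 -> #|neighbours b| = l.+1 ->
    (forall w, w \notin [set a; b] -> #|neighbours w| = l) ->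
  leaky_number r l = #|~: [set a; b]|.
Proof.
move=> std_r r_adj l_gt0 disj deg_a deg_b deg; apply/leaky_numberP; split.
  exists (~: [set a; b]) => //.
  exact: leaky_forcing_sub std_r (standard_forcing_pair _ _ _ _).
move=> B fB; rewrite subset_leq_card //; apply/subsetP=> w.
by rewrite in_setC => /deg deg_w; apply: leaky_forcing_degree fB.
Qed.

End Forcing.

(** Reduces the unordered-pair tests of [add_edge_adj] and [del_edge_adj] to comparisons of
    endpoints. *)
Lemma eq_set2 (T : finType) (x y a b : T) :
  ([set x; y] == [set a; b]) = (x == a) && (y == b) || (x == b) && (y == a).
Proof.
apply/eqP/idP=> [/setP E|/orP[]/andP[/eqP-> /eqP->] //]; last exact: setUC.
have := E b; have := E a; have := E y; have := E x.
rewrite !inE !eqxx ?orbT (eq_sym a x) (eq_sym b x) (eq_sym a y) (eq_sym b y).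
by case: (x == a); case: (x == b); case: (y == a); case: (y == b).
Qed.

Section Edges.

Variable X : sgraph.
Implicit Types a b x : X.

Lemma neighbours_add_edge_l a b : a != b ->
  neighbours (a : add_edge a b) = b |: neighbours a.
Proof.
move=> ab; apply/setP=> y; rewrite !inE /= /add_edge_adj eq_set2 eqxx (negPf ab).
by case: (y =P b) => [->|_] /=; rewrite ?ab ?orbT ?andbF ?orbF.
Qed.

Lemma neighbours_add_edge_r a b : a != b ->
  neighbours (b : add_edge a b) = a |: neighbours b.
Proof.
rewrite eq_sym => ba; rewrite -(neighbours_add_edge_l ba); apply/setP=> y.
by rewrite !inE /= /add_edge_adj [[set a; b]]setUC.
Qed.

Lemma neighbours_add_edge_out a b x : x \notin [set a; b] ->
  neighbours (x : add_edge a b) = neighbours x.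
Proof.
rewrite !inE => /norP[xa xb]; apply/setP=> y.
by rewrite !inE /= /add_edge_adj eq_set2 (negPf xa) (negPf xb) andbF orbF.
Qed.

Lemma neighbours_del_add_edge a b x : ~~ adj a b ->
  neighbours (x : @del_edge (add_edge a b) a b) = neighbours x.
Proof.
move=> ab; apply/setP=> y; rewrite !inE /= /del_edge_adj /= /add_edge_adj.
rewrite andb_orl -andbA andbN andbF orbF eq_set2.
case xy: (adj x y) => //=; apply/norP; split; apply/negP.
  by case/andP=> /eqP xE /eqP yE; rewrite -xE -yE xy in ab.
by case/andP=> /eqP xE /eqP yE; rewrite -xE -yE adj_sym xy in ab.
Qed.

End Edges.

(** The neighbours of a vertex are the other [l] vertices of its own copy, embedded by [inl] or
    [inr]. *)
Lemma degree_Hgraph l (w : Hgraph l) : #|neighbours w| = l.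
Proof.
case: w => w.
  have -> : neighbours (inl w : Hgraph l) = inl @: [set~ w].
    apply/setP=> -[y|y]; rewrite !inE; last by apply/esym/imsetP=> -[].
    by rewrite mem_imset ?inE /= 1?eq_sym // => ? ? [].
  by rewrite card_imset ?cardsC1 ?card_ord // => ? ? [].
have -> : neighbours (inr w : Hgraph l) = inr @: [set~ w].
  apply/setP=> -[y|y]; rewrite !inE; first by apply/esym/imsetP=> -[].
  by rewrite mem_imset ?inE /= 1?eq_sym // => ? ? [].
by rewrite card_imset ?cardsC1 ?card_ord // => ? ? [].
Qed.

Lemma card_Hgraph l : #|Hgraph l| = (2 * l + 2)%N.
Proof. by rewrite card_sum card_ord addSn addnS addnn -mul2n addn2. Qed.

Lemma leaky_number_Ggraph l (u v : complete_graph l.+1)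
    (r : {set Ggraph u v} -> rel (Ggraph u v)) :
    (0 < l)%N ->
    (forall B x y, standard_force B x y -> r B x y) ->
    (forall B x y, r B x y -> adj x y) ->
  leaky_number r l = (2 * l)%N.
Proof.
move=> l_gt0 std_r r_adj.
rewrite (leaky_number_pair (X := Ggraph u v) (a := inl u) (b := inr v) std_r r_adj l_gt0).
- by rewrite cardsCs setCK cards2 card_Hgraph addnK.
(* The neighbourhoods of [u] and [v] lie in opposite copies except for the ends of the new edge: a
   common neighbour could only be [u] or [v], and neither is its own neighbour. *)
- rewrite -setI_eq0 (neighbours_add_edge_l (X := Hgraph l)) //.
  rewrite (neighbours_add_edge_r (X := Hgraph l)) //.
  apply/eqP/setP=> -[y|y]; rewrite !inE /= ?orbF; apply/andP=> -[].
    by move=> uy /eqP[yu]; rewrite yu eqxx in uy.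
  by move=> /eqP[->]; rewrite eqxx.
- rewrite (neighbours_add_edge_l (X := Hgraph l)) //.
  by rewrite cardsU1 degree_Hgraph inE.
- rewrite (neighbours_add_edge_r (X := Hgraph l)) //.
  by rewrite cardsU1 degree_Hgraph inE.
by move=> w wuv; rewrite (neighbours_add_edge_out (X := Hgraph l)) ?degree_Hgraph.
Qed.

Theorem theorem7 (l : nat) (hl : (1 <= l)%N) (u v : complete_graph l.+1) :
  let H := Hgraph l in
  let G := Ggraph u v in
  let G' := @del_edge G (inl u) (inr v) in
  [/\ Zpsd l G = (2 * l)%N /\ Zstd l G = (2 * l)%N,
      Zpsd l H = (2 * l + 2)%N /\ Zstd l H = (2 * l + 2)%N &
      (Zpsd l G)%:Z - (Zpsd l G')%:Z = -2 /\
      (Zstd l G)%:Z - (Zstd l G')%:Z = -2].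
Proof.
move=> H G G'.
have psdG : Zpsd l G = (2 * l)%N.
  exact: leaky_number_Ggraph hl (@standard_force_psd _) (@psd_force_adj _).
have stdG : Zstd l G = (2 * l)%N.
  exact: leaky_number_Ggraph hl (fun _ _ _ => id) (@standard_force_adj _).
(* [G'] is not the same record as [H], but it has the same vertex type and the same neighbourhoods,
   and [leaky_number_regular] needs only the degrees. *)
have degG' (w : G') : #|neighbours w| = l.
  by rewrite (neighbours_del_add_edge (X := H)) ?degree_Hgraph.
have psdG' : Zpsd l G' = (2 * l + 2)%N.
  by rewrite -card_Hgraph; apply: leaky_number_regular degG'; apply: psd_force_adj.
have stdG' : Zstd l G' = (2 * l + 2)%N.
  rewrite -card_Hgraph; apply: leaky_number_regular degG'.
  exact: standard_force_adj.
have drop2 : (2 * l)%N%:Z - (2 * l + 2)%N%:Z = -2.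
  by rewrite PoszD opprD addNKr.
split; [by [] | split | by rewrite psdG psdG' stdG stdG'].
  rewrite -card_Hgraph; apply: leaky_number_regular (@degree_Hgraph l).
  exact: psd_force_adj.
rewrite -card_Hgraph; apply: leaky_number_regular (@degree_Hgraph l).
exact: standard_force_adj.
Qed.
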